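(* Let $(\vec x,\vec y)$ be a totally positive specialization, written as $x_k=c_k(1+t_{k-1})$, $y_k=c_kc_{k+1}t_k$ for $k\ge1$ with $t_0=0$ and positive real sequences $\vec c=(c_1,c_2,\ldots)$, $\vec t=(t_1,t_2,\ldots)$. Then for every $n\ge0$ the associated $n$-th Stieltjes moment is $$a_n=\sum_{\pi\in\mathrm{NC}(n)}\ \prod_{k\ge1}c_k^{\,\ell_{k-1}(\pi)}\,t_k^{\,g_k(\pi)},$$ where the sum is over all non-crossing set partitions of $\{1,\ldots,n\}$.
   Context: Totally positive specialization: the semi-infinite tridiagonal matrix with diagonal $x_1,x_2,\ldots$, superdiagonal $y_1,y_2,\ldots$ and subdiagonal entries $1$ has all its not identically vanishing minors positive; this is equivalent to the existence of (unique) positive real sequences $\vec c=(c_1,c_2,\ldots)$, $\vec t=(t_1,t_2,\ldots)$ such that $x_k=c_k(1+t_{k-1})$ and $y_k=c_kc_{k+1}t_k$ for all $k\ge1$, with the convention $t_0=0$. Moments (normalized by $a_0=1$): coefficients of the Jacobi continued fraction $$\sum_{n\ge0}a_nz^n=\cfrac{1}{1-x_1z-\cfrac{y_1z^2}{1-x_2z-\cfrac{y_2z^2}{1-x_3z-\ddots}}}\ ;$$ equivalently, $a_n$ is the sum over Motzkin paths of length $n$ (from $(0,0)$ to $(n,0)$, staying weakly above the axis) of the product of step weights, where an up step from height $k-1$ to $k$ has weight $y_k$, a horizontal step at height $k$ has weight $x_{k+1}$, and down steps have weight $1$. Set partition statistics: for a set partition $\pi$ of $\{1,\ldots,n\}$,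 list each block in increasing order; $a$ precedes $b$ (and $b$ succeeds $a$) if they are consecutive elements of the same block. $\pi$ is non-crossing if there are no $a<c<b<d$ with $a$ preceding $b$ and $c$ preceding $d$. An element is a singleton if its block has size one; an opener (resp. closer) if it is the minimum (resp. maximum) of a non-singleton block; a transient otherwise. $\mathcal C(\pi),\mathcal T(\pi)$ denote the sets of closers and transients. $\Gamma_i(\pi)$ is the set of openers or transients $a<i$ such that $i\le b$, where $b$ is the element succeeding $a$. For $i\in\mathcal C(\pi)\cup\mathcal T(\pi)$, $\gamma_i(\pi)$ is the position (starting from 1) of the element preceding $i$ in the increasing list of elements of $\Gamma_i(\pi)$. Then $\ell_k(\pi)=\#\{1\le i\le n:\#\Gamma_i(\pi)=k\}$ for $k\ge0$, and $g_m(\pi)=\#\{i\in\mathcal C(\pi)\cup\mathcal T(\pi):\gamma_i(\pi)=m\}$ for $m\ge1$. *)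

(* Defs.v *)
From HB Require Import structures.
From mathcomp Require Import all_boot all_order all_algebra.
From mathcomp Require Import reals.
Set Implicit Arguments.
Unset Strict Implicit.
Unset Printing Implicit Defensive.
Import Order.TTheory GRing.Theory Num.Theory.

(* Sequences x_1, x_2, ... are functions nat -> R whose value at 0 is not     *)
(* used.                                                                      *)

Section TotalPositivity.
Variable R : realType.
Local Open Scope ring_scope.

(* Rows and columns are numbered from 0, so that the entry (i, i) is x_{i+1}. *)
Definition tridiag (x y : nat -> R) (i j : nat) : R :=
  if j == i then x i.+1
  else if j == i.+1 then y i.+1
  else if i == j.+1 then 1
  else 0.

Definition tridiag_minor (x y : nat -> R) (r : nat) (f g : 'I_r -> nat) : R :=
  \det (\matrix_(i < r, j < r) tridiag x y (f i) (g j)).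

(* A minor is a polynomial in the entries x_k, y_k; over the infinite field R *)
(* it is not identically zero iff it is nonzero at some (x', y').             *)
Definition totally_positive (x y : nat -> R) : Prop :=
  forall (r : nat) (f g : 'I_r -> nat),
    {homo f : i j / (i < j)%N} -> {homo g : i j / (i < j)%N} ->
    (exists x' y' : nat -> R, tridiag_minor x' y' f g <> 0) ->
    0 < tridiag_minor x y f g.

End TotalPositivity.

(* Formal power series, represented by their sequences of coefficients. *)
Section Moments.
Variable R : realType.
Local Open Scope ring_scope.
Implicit Types u v f g x y : nat -> R.

Definition fps_one (n : nat) : R := (n == 0%N)%:R.

Definition fps_mul f g (n : nat) : R := \sum_(i < n.+1) f i * g (n - i)%N.

(* The series 1 / (1 - u) = 1 + u + u^2 + ... for u with zero constant term:  *)
(* then u^k does not contribute to the coefficient of z^n when k > n.         *)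
Definition fps_geom u (n : nat) : R :=
  \sum_(k < n.+1) iter k (fps_mul u) fps_one n.

(* The series a z + b z^2 f(z). *)
Definition fps_step (a b : R) f (n : nat) : R :=
  match n with 0 => 0 | 1 => a | m.+2 => b * f m end.

(* The finite continued fraction with N levels, starting at level k:          *)
(* 1 / (1 - x_{k+1} z - y_{k+1} z^2 / (1 - x_{k+2} z - ...)).                 *)
Fixpoint jfrac x y (N k : nat) : nat -> R :=
  if N is N'.+1 then
    fps_geom (fps_step (x k.+1) (y k.+1) (jfrac x y N' k.+1))
  else fun=> 0.

(* The coefficient of z^n in the infinite Jacobi continued fraction; by       *)
(* moment_lim below, it is the eventual value of the coefficient of z^n in    *)
(* the finite truncations of the fraction.                                    *)
Definition moment x y (n : nat) : R := jfrac x y n.+1 0 n.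

Lemma fps_pow_eq0 u k n : u 0%N = 0 -> (n < k)%N ->
  iter k (fps_mul u) fps_one n = 0.
Proof.
move=> u0; elim: k n => // k IHk n ltnk /=.
rewrite /fps_mul big1 // => -[[|i] lti] _ /=; first by rewrite u0 mul0r.
rewrite IHk ?mulr0 //; rewrite !ltnS in lti ltnk; apply: leq_trans ltnk.
by rewrite ltn_subrL /=; apply: leq_trans lti.
Qed.

Lemma fps_geom_widen u n K : u 0%N = 0 -> (n < K)%N ->
  fps_geom u n = \sum_(k < K) iter k (fps_mul u) fps_one n.
Proof.
move=> u0 ltnK; rewrite /fps_geom.
rewrite -!(big_mkord xpredT (fun k => iter k (fps_mul u) fps_one n)).
rewrite [RHS](big_cat_nat (n := n.+1)) //= [X in _ = _ + X]big_nat.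
rewrite [X in _ = _ + X]big1 ?addr0 //.
by move=> k /andP[ltnk _]; apply: fps_pow_eq0.
Qed.

Lemma fps_geomE u n : u 0%N = 0 ->
  fps_geom u n = fps_one n + fps_mul u (fps_geom u) n.
Proof.
move=> u0; rewrite (fps_geom_widen u0 (ltnSn _)) big_ord_recl /=.
congr (_ + _); rewrite exchange_big /=; apply: eq_bigr => -[[|i] lti] _ /=.
  by rewrite u0 mul0r big1 // => j _; rewrite mul0r.
rewrite -mulr_sumr; congr (_ * _).
rewrite (@fps_geom_widen _ _ n) // ltn_subrL /=.
by rewrite ltnS in lti; apply: leq_trans lti.
Qed.

Lemma eq_fps_pow u v n k : (forall i, (i <= n)%N -> u i = v i) ->
  iter k (fps_mul u) fps_one n = iter k (fps_mul v) fps_one n.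
Proof.
elim: k n => // k IHk n equv /=; apply: eq_bigr => -[i lti] _ /=.
rewrite equv //; congr (_ * _); apply: IHk => j lej; apply: equv.
by apply: leq_trans lej (leq_subr _ _).
Qed.

Lemma jfrac_stable x y N M k n : (n < N)%N -> (n < M)%N ->
  jfrac x y N k n = jfrac x y M k n.
Proof.
elim: N M k n => [//|N IHN] [//|M] k n ltnN ltnM /=.
apply: eq_bigr => j _; apply: eq_fps_pow => -[|[|i]] //= lei.
by rewrite (IHN M) //; [move: ltnN | move: ltnM]; rewrite ltnS => len;
  apply: leq_trans len; apply: leq_trans lei.
Qed.

Lemma moment_lim x y N n : (n < N)%N -> jfrac x y N 0 n = moment x y n.
Proof. by move=> ltnN; apply: jfrac_stable. Qed.

End Moments.

(* A set partition of {1, ..., n} is P : {set {set 'I_n}} such that           *)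
(* partition P [set: 'I_n], the element i : 'I_n standing for i + 1.          *)
Section SetPartitions.
Variable n : nat.
Implicit Types (P : {set {set 'I_n}}) (i a b c d : 'I_n).

Definition precedes P a b : bool :=
  [exists B in P, [&& a \in B, b \in B, a < b &
                      [forall c in B, ~~ (a < c < b)]]].

Definition noncrossing P : bool :=
  [forall a : 'I_n, forall b : 'I_n, forall c : 'I_n, forall d : 'I_n,
     ~~ [&& a < c, c < b, b < d, precedes P a b & precedes P c d]].

Definition NC : {set {set {set 'I_n}}} :=
  [set P | partition P [set: 'I_n] & noncrossing P].

Definition singletons P : {set 'I_n} := [set i | #|pblock P i| == 1].

Definition openers P : {set 'I_n} :=
  [set i | (i \notin singletons P) && [forall j in pblock P i, i <= j]].

Definition closers P : {set 'I_n} :=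
  [set i | (i \notin singletons P) && [forall j in pblock P i, j <= i]].

Definition transients P : {set 'I_n} :=
  ~: (singletons P :|: openers P :|: closers P).

Definition Gamma P i : {set 'I_n} :=
  [set a in openers P :|: transients P |
     (a < i) && [exists b : 'I_n, precedes P a b && (i <= b)]].

(* The list enum (Gamma P i) is increasing. The value 0 is only taken when i  *)
(* has no predecessor, that is, outside closers P :|: transients P.           *)
Definition gamma P i : nat :=
  if [pick a | precedes P a i] is Some a
  then (index a (enum (Gamma P i))).+1 else 0.

Definition ell_stat P (k : nat) : nat := #|[set i | #|Gamma P i| == k]|.

Definition g_stat P (m : nat) : nat :=
  #|[set i in closers P :|: transients P | gamma P i == m]|.

(* By ell_stat_eq0 and g_stat_eq0, all factors of the product over k >= 1 of  *)
(* c_k ^ l_{k-1} * t_k ^ g_k with k > n are equal to 1.                       *)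
Lemma card_Gamma_le P i : #|Gamma P i| <= i.
Proof.
rewrite cardE -(size_map val) -[leqRHS](size_iota 0).
apply: uniq_leq_size => [|_ /mapP[a + ->]].
  by rewrite map_inj_uniq ?enum_uniq //; apply: val_inj.
by rewrite mem_enum !inE mem_iota => /andP[_ /andP[]].
Qed.

Lemma ell_stat_eq0 P k : n <= k -> ell_stat P k = 0.
Proof.
move=> lenk; apply: eq_card0 => i; rewrite !inE; apply/negbTE.
by rewrite neq_ltn (leq_ltn_trans (card_Gamma_le P i)) // (leq_trans _ lenk).
Qed.

Lemma g_stat_eq0 P m : n < m -> g_stat P m = 0.
Proof.
move=> ltnm; apply: eq_card0 => i; rewrite !inE; apply/negbTE.
rewrite negb_and; apply/orP; right; rewrite neq_ltn; apply/orP; left.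
apply: leq_ltn_trans ltnm; rewrite /gamma; case: pickP => // a _.
apply: leq_ltn_trans (ltn_ord i); apply: leq_trans (card_Gamma_le P i).
by rewrite cardE index_size.
Qed.

End SetPartitions.

(* Main.v *)
(* Record for each element i whether it has a predecessor and whether it has a *)
(* successor.  In a non-crossing partition an element with a predecessor       *)
(* closes the most recently opened arc, so this word of n letters determines   *)
(* the partition, and gamma_i = #Gamma_i.  Reading the letters as steps of a   *)
(* Motzkin path at height h = #Gamma_i, with two colours (singleton or         *)
(* transient) for the horizontal steps, the weight of a partition becomes the  *)
(* product of the step weights c_{h+1}, times t_h for an element with a        *)
(* predecessor; as t_0 = 0, words that would go below the axis contribute 0.   *)
(* A horizontal step then has total weight c_{h+1} (1 + t_h) = x_{h+1}, and an *)
(* up step from h - 1 together with the matching down step                     *)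
(* c_h c_{h+1} t_h = y_h, which is the continued fraction.                     *)
Require Import Defs.
From HB Require Import structures.
From mathcomp Require Import all_boot all_order all_algebra.
From mathcomp Require Import zify ring.
From mathcomp Require Import reals.
Set Implicit Arguments.
Unset Strict Implicit.
Unset Printing Implicit Defensive.
Import Order.TTheory GRing.Theory Num.Theory.

(** * Predecessors and successors *)

(** Both sides equal one weighted sum over words of length [n] in four letters, each letter telling
    whether an element has a predecessor and whether it has a successor.

    Partition side: [mem_stack_word] shows that the stack of the word of a non-crossing partition
    holds exactly the starts of the open arcs, and the predecessor of an element, if any, is on top.
    Hence the word determines the partition ([precedes_NC], [word_inj]), both statistics are stack
    heights ([size_stack_word], [gamma_NC]), and [NC_weight] turns the product over [k] into a
    product over letters. Conversely, [word_surj] builds a partition from each word that never pops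
    an empty stack and ends with an empty one; every other word weighs 0, through [t 0 = 0] or the
    final height. This gives [sum_NC_words].

    Fraction side: removing the first letter gives a recurrence in the starting height and the
    length ([path_sumS]). The products [descent] of tails of the fraction satisfy the same
    recurrence ([descentS]) with the same initial values ([descent0]), because y_h = c_h (c_{h+1}
    t_h) splits into the weights of an up step and of its matching down step. At height 0 the
    product is the continued fraction itself. *)

Section Blocks.
Variables (n : nat) (P : {set {set 'I_n}}).
Hypothesis partP : partition P [set: 'I_n].
Implicit Types a b i j : 'I_n.

Lemma mem_pblockE i j : (i \in pblock P j) = (pblock P i == pblock P j).
Proof.
have [/eqP covP trivP _] := and3P partP.
by rewrite eq_sym eq_pblock // covP inE.
Qed.

Lemma precedesP a b :
  reflect [/\ pblock P a = pblock P b, a < b &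
              forall k, pblock P k = pblock P a -> ~~ (a < k < b)]
          (precedes P a b).
Proof.
have [/eqP covP trivP _] := and3P partP.
apply: (iffP existsP) => [[B /and5P[PB aB bB ab /forallP noB]]|[Eab ab noB]].
  have blockB i : i \in B -> pblock P i = B by move=> iB; apply: def_pblock.
  split=> // [|k]; first by rewrite !blockB.
  rewrite (blockB a) // => Ek; have := noB k.
  by rewrite -Ek mem_pblockE eqxx.
exists (pblock P a); rewrite pblock_mem ?covP ?inE // !mem_pblockE Eab !eqxx ab /=.
apply/forallP => k; apply/implyP; rewrite mem_pblockE => /eqP Ek.
by apply: noB; rewrite Ek.
Qed.

Lemma exists_pred i j : pblock P i = pblock P j -> i < j ->
  exists2 a, precedes P a j & i <= a.
Proof.
move=> Eij ltij; pose p a := (pblock P a == pblock P j) && (a < j).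
have pi : p i by rewrite /p Eij eqxx.
case: (arg_maxnP (@nat_of_ord n) pi) => a /andP[/eqP Ea ltaj] amax.
exists a; last exact: amax.
apply/precedesP; split=> // k Ek; apply/negP => /andP[ltak ltkj].
have : k <= a by apply: amax; rewrite /p Ek Ea eqxx ltkj.
by rewrite leqNgt ltak.
Qed.

Lemma exists_succ i j : pblock P i = pblock P j -> i < j ->
  exists b, precedes P i b.
Proof.
move=> Eij ltij; pose p b := (pblock P b == pblock P i) && (i < b).
have pj : p j by rewrite /p Eij eqxx.
case: (arg_minnP (@nat_of_ord n) pj) => b /andP[/eqP Eb ltib] bmin.
exists b; apply/precedesP; split=> // k Ek; apply/negP => /andP[ltik ltkb].
have : b <= k by apply: bmin; rewrite /p Ek eqxx ltik.
by rewrite leqNgt ltkb.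
Qed.

Lemma precedes_lt a b : precedes P a b -> a < b.
Proof. by case/precedesP. Qed.

Lemma precedes_injl a a' b : precedes P a b -> precedes P a' b -> a = a'.
Proof.
move=> /precedesP[Ea ab noa] /precedesP[Ea' ab' noa'].
apply: ord_inj; apply/eqP; rewrite eqn_leq.
apply/andP; split; rewrite leqNgt; apply/negP => lt.
  by apply: (negP (noa' a (etrans Ea (esym Ea')))); apply/andP.
by apply: (negP (noa a' (etrans Ea' (esym Ea)))); apply/andP.
Qed.

Lemma precedes_injr a b b' : precedes P a b -> precedes P a b' -> b = b'.
Proof.
move=> /precedesP[Eb ab nob] /precedesP[Eb' ab' nob'].
apply: ord_inj; apply/eqP; rewrite eqn_leq.
apply/andP; split; rewrite leqNgt; apply/negP => lt.
  by apply: (negP (nob b' (esym Eb'))); apply/andP.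
by apply: (negP (nob' b (esym Eb))); apply/andP.
Qed.

Definition has_pred i := [exists a, precedes P a i].
Definition has_succ i := [exists b, precedes P i b].

Lemma has_predPn i :
  reflect (forall j, pblock P j = pblock P i -> i <= j) (~~ has_pred i).
Proof.
apply: (iffP existsPn) => [no j Ej | imin a].
  by rewrite leqNgt; apply/negP => /(exists_pred Ej)[a /(negP (no a))].
by apply/negP => /precedesP[/imin + lt]; rewrite leqNgt lt.
Qed.

Lemma has_succPn i :
  reflect (forall j, pblock P j = pblock P i -> j <= i) (~~ has_succ i).
Proof.
apply: (iffP existsPn) => [no j /esym Ej | imax b].
  by rewrite leqNgt; apply/negP => /(exists_succ Ej)[b /(negP (no b))].
by apply/negP => /precedesP[/esym/imax + lt]; rewrite leqNgt lt.
Qed.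

Lemma in_singletons i : (i \in singletons P) = ~~ has_pred i && ~~ has_succ i.
Proof.
rewrite inE; apply/cards1P/andP => [[k Ek]|[/has_predPn imin /has_succPn imax]].
  have eqk j : pblock P j = pblock P i -> j = k.
    by move=> Ej; apply/set1P; rewrite -Ek mem_pblockE Ej.
  by split; [apply/has_predPn | apply/has_succPn] => j /eqk->; rewrite (eqk i).
exists i; apply/setP => j; rewrite inE mem_pblockE.
apply/eqP/eqP => [Ej|->//]; apply: ord_inj; apply/eqP.
by rewrite eqn_leq imin // imax.
Qed.

Lemma in_openers i : (i \in openers P) = ~~ has_pred i && has_succ i.
Proof.
rewrite inE in_singletons.
have -> : [forall j in pblock P i, i <= j] = ~~ has_pred i.
  apply/forall_inP/has_predPn => imin j; last by rewrite mem_pblockE => /eqP/imin.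
  by move=> Ej; apply: imin; rewrite mem_pblockE Ej.
by case: has_pred; case: has_succ.
Qed.

Lemma in_closers i : (i \in closers P) = has_pred i && ~~ has_succ i.
Proof.
rewrite inE in_singletons.
have -> : [forall j in pblock P i, j <= i] = ~~ has_succ i.
  apply/forall_inP/has_succPn => imin j; last by rewrite mem_pblockE => /eqP/imin.
  by move=> Ej; apply: imin; rewrite mem_pblockE Ej.
by case: has_pred; case: has_succ.
Qed.

Lemma in_transients i : (i \in transients P) = has_pred i && has_succ i.
Proof.
rewrite in_setC !in_setU in_singletons in_openers in_closers.
by case: has_pred; case: has_succ.
Qed.

(** Openers and transients together are the elements with a successor, so membership in [Gamma]
    concerns only the arc starting at [a]. *)
Lemma in_GammaP a i :
  reflect (exists2 b, precedes P a b & a < i <= b) (a \in Gamma P i).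
Proof.
rewrite inE in_setU in_openers in_transients -andb_orl orNb /=.
apply: (iffP and3P) => [[_ lti /existsP[b /andP[ab ib]]]|[b ab /andP[lti ib]]].
  by exists b; rewrite ?lti.
by split=> //; apply/existsP; exists b; rewrite ?ab.
Qed.

End Blocks.

(** Blocks are chains of predecessors: if [i < j] share a block, [j] has a predecessor [a >= i],
    which both partitions put in the block of [j]. Induction on the larger element then links [i] to
    [a]. *)
Lemma precedes_inj n (P Q : {set {set 'I_n}}) :
    partition P [set: 'I_n] -> partition Q [set: 'I_n] ->
  (forall a b, precedes P a b = precedes Q a b) -> P = Q.
Proof.
have sub (P' Q' : {set {set 'I_n}}) :
    partition P' [set: 'I_n] -> partition Q' [set: 'I_n] ->
    (forall a b, precedes P' a b = precedes Q' a b) ->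
    forall i j, pblock P' i = pblock P' j -> pblock Q' i = pblock Q' j.
  move=> partP partQ eqPQ.
  have lt_sub m (i j : 'I_n) : j < m -> i <= j ->
      pblock P' i = pblock P' j -> pblock Q' i = pblock Q' j.
    elim: m i j => // m IHm i j ltjm.
    rewrite leq_eqVlt => /predU1P[/val_inj-> //|ltij] Eij.
    have [a Paj leia] := exists_pred partP Eij ltij.
    have [Eaj ltaj _] := precedesP partP _ _ Paj.
    have [<- _ _] := precedesP partQ _ _ (etrans (esym (eqPQ a j)) Paj).
    by apply: IHm; rewrite ?Eaj //; lia.
  move=> i j Eij; case/orP: (leq_total i j) => leij.
    by apply: (lt_sub j.+1).
  by symmetry; apply: (lt_sub i.+1).
move=> partP partQ eqPQ.
rewrite -(equivalence_partition_pblock partP) -(equivalence_partition_pblock partQ).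
apply: eq_in_imset => i _; apply/setP => j; rewrite !inE !mem_pblockE //.
apply/eqP/eqP; first exact: (sub P Q).
by apply: (sub Q P).
Qed.

(** * Partitions from parent functions *)

Section ParentPartition.
Variables (n : nat) (f : 'I_n -> 'I_n).
Hypothesis f_le : forall i, f i <= i.
Hypothesis f_inj : forall i j, f i < i -> f j < j -> f i = f j -> i = j.
Implicit Types i j : 'I_n.

Let root i := iter n f i.

Definition parent_partition := preim_partition root [set: 'I_n].

Let root_fix i : f (root i) = root i.
Proof.
(* The iterates drop by at least one until they reach a fixed point, and [i < n], so [n] iterations
   suffice. *)
have step k : f (iter k f i) = iter k f i \/ iter k f i + k <= i.
  elim: k => [|k IHk]; first by right; rewrite addn0.
  rewrite iterS; case: IHk => [E|le]; first by left; rewrite !E.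
  have := f_le (iter k f i); rewrite leq_eqVlt => /predU1P[/val_inj E|lt].
    by left; rewrite !E.
  by right; lia.
case: (step n) => // le; have := ltn_ord i; lia.
Qed.

Let root_f i : root (f i) = root i.
Proof. by rewrite /root -iterSr iterS; apply: root_fix. Qed.

Let root_le i : root i <= i.
Proof.
have iter_le k : iter k f i <= i by elim: k => //= k; apply: leq_trans.
exact: iter_le.
Qed.

Lemma parent_partitionP : partition parent_partition [set: 'I_n].
Proof. exact: preim_partitionP. Qed.

Let pblock_parent i j :
  (pblock parent_partition i = pblock parent_partition j) <-> root i = root j.
Proof.
have [/eqP cov triv _] := and3P parent_partitionP.
suff E : (pblock parent_partition i == pblock parent_partition j) = (root i == root j).
  by split=> /eqP; [rewrite E | rewrite -E] => /eqP.
rewrite eq_pblock ?cov ?inE //.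
apply: pblock_equivalence_partition; rewrite ?inE //.
by move=> x y z _ _ _; split=> // /eqP->.
Qed.

(* If i lay strictly between f j and j, the chains of parents of i and j would *)
(* merge at a common parent, against f_inj.                                   *)
Let parent_max m i j : j < m -> root i = root j -> i < j -> f j < j /\ i <= f j.
Proof.
elim: m i j => // m IHm i j ltjm Eij ltij.
have ltfj : f j < j.
  rewrite ltn_neqAle f_le andbT; apply/eqP => /val_inj Efj.
  have Erj : root j = j by apply: iter_fix.
  by have := root_le i; rewrite Eij Erj; lia.
split=> //; rewrite leqNgt; apply/negP => ltfi.
elim: {i}(i : nat) {-2}i (leqnn i) Eij ltij ltfi => [|q IHq] i leiq Eij ltij ltfi.
  by lia.
have [|||ltfii lefji] := IHm (f j) i; rewrite ?root_f ?Eij //; first by lia.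
move: lefji; rewrite leq_eqVlt => /predU1P[/val_inj Ef|lt].
  by move: ltij; rewrite (f_inj ltfj ltfii Ef) ltnn.
by apply: (IHq (f i)); rewrite ?root_f //; lia.
Qed.

Lemma precedes_parent i j :
  precedes parent_partition i j = (f j == i) && (i < j).
Proof.
apply/(precedesP parent_partitionP)/andP => [[/pblock_parent Eij ltij noP]|].
  split=> //; have [ltfj leif] := parent_max (leqnn _) Eij ltij.
  apply/eqP/val_inj/eqP; rewrite eqn_leq leif andbT leqNgt; apply/negP => lt.
  have := noP (f j); rewrite lt ltfj => /(_ _)/negP; apply=> //.
  by apply/pblock_parent; rewrite root_f.
case=> /eqP<- ltij; split=> // [|k /pblock_parent Ek].
  by apply/pblock_parent; rewrite root_f.
rewrite root_f in Ek; apply/negP => /andP[ltk ltkj].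
by have [_] := parent_max (leqnn _) Ek ltkj; rewrite leqNgt ltk.
Qed.

End ParentPartition.

(** * Words and their stacks *)

Section Stack.
Implicit Types (s : seq (bool * bool)) (a k l : nat).

Definition letter s k : bool * bool := nth (false, false) s k.

(* A letter (p, q) says whether the element has a predecessor and a successor; *)
(* the stack holds the starting points of the open arcs, latest first.         *)
Fixpoint stack s k : seq nat :=
  if k is l.+1 then
    let r := if (letter s l).1 then behead (stack s l) else stack s l in
    if (letter s l).2 then l :: r else r
  else [::].

(** Truncated subtraction matches [behead [::] = [::]], so [size_stack] holds even for words that
    pop an empty stack. *)
Definition next_height (h : nat) (u : bool * bool) : nat := h - u.1 + u.2.

Lemma mem_stackS s k a : a \in stack s k.+1 -> a = k /\ (letter s k).2 \/
  a \in (if (letter s k).1 then behead (stack s k) else stack s k).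
Proof.
by rewrite /=; case: (letter s k).2; [rewrite inE => /predU1P[]|]; auto.
Qed.

Lemma mem_pop s k a :
  a \in (if (letter s k).1 then behead (stack s k) else stack s k) ->
  a \in stack s k.
Proof. by case: ifP => // _; apply: mem_behead. Qed.

Lemma stack_lt s k a : a \in stack s k -> a < k.
Proof.
elim: k => // k IHk /mem_stackS[[->//]|/mem_pop/IHk]; lia.
Qed.

Lemma stack_sorted s k : sorted gtn (stack s k).
Proof.
elim: k => //= k IHk.
have {}IHk : sorted gtn (if (letter s k).1 then behead (stack s k) else stack s k).
  by case: ifP => // _; case: (stack s k) IHk => //= b r; apply: path_sorted.
case: ifP => // _ /=; rewrite path_min_sorted //.
by apply/allP => a /mem_pop/stack_lt.
Qed.

Lemma stack_uniq s k : uniq (stack s k).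
Proof.
apply: sorted_uniq (stack_sorted s k) => [a b c /= | a /=]; last exact: ltnn.
by move=> lt1 lt2; apply: ltn_trans lt1.
Qed.

Lemma stack_letter s k a : a \in stack s k -> (letter s a).2.
Proof. by elim: k => // k IHk /mem_stackS[[->//]|/mem_pop/IHk]. Qed.

(** A position is pushed only at its own time, so once popped it never returns. *)
Lemma stack_antimono s a k l :
  a < k -> k <= l -> a \in stack s l -> a \in stack s k.
Proof.
move=> ltak; elim: l => [|l IHl]; first by rewrite leqn0 => /eqP->.
rewrite leq_eqVlt => /predU1P[->//|lekl] /mem_stackS[[Eal]|/mem_pop/IHl]; last exact.
by move: lekl; rewrite -Eal; lia.
Qed.

Lemma stack_head_max s k a : a \in stack s k -> a <= head 0 (stack s k).
Proof.
have := stack_sorted s k; case: (stack s k) => //= b r.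
rewrite (path_sortedE (@rev_trans _ _ ltn_trans)) => /andP[/allP ltb _].
by rewrite inE => /predU1P[->//|/ltb/ltnW].
Qed.

Lemma pop_notin s k : (letter s k).1 -> stack s k != [::] ->
  head 0 (stack s k) \notin stack s k.+1.
Proof.
move=> pk ne; apply/negP => /mem_stackS; rewrite pk => -[[Ek _]|].
  suff : head 0 (stack s k) < k by rewrite Ek ltnn.
  by apply: (@stack_lt s); case: (stack s k) ne => // b r _; rewrite mem_head.
by have := stack_uniq s k; case: (stack s k) ne => //= b r _ /andP[/negP].
Qed.

Lemma notin_pop s k a : a \in stack s k -> a \notin stack s k.+1 ->
  (letter s k).1 /\ a = head 0 (stack s k).
Proof.
rewrite /=; case: (letter s k).1 => ak; last first.
  by case: ifP; rewrite ?inE ?ak ?orbT.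
move=> akN; split=> //.
have {akN} : a \notin behead (stack s k).
  by move: akN; case: ifP => // _; rewrite inE negb_or => /andP[].
by case: (stack s k) ak => //= b r; rewrite inE => /predU1P[//|->].
Qed.

Lemma size_stack s k : k <= size s ->
  size (stack s k) = foldl next_height 0 (take k s).
Proof.
elim: k => [|k IHk] leks; first by rewrite take0.
rewrite (take_nth (false, false)) // -cats1 foldl_cat /= -IHk 1?ltnW //.
rewrite /next_height -/(letter s k).
by case: (letter s k) => [[] []] /=; rewrite ?size_behead; lia.
Qed.

End Stack.

(** * From admissible words to non-crossing partitions *)

Section WordPartition.
Variables (n : nat) (s : seq (bool * bool)).
Hypothesis pop_ok : forall k, k < n -> (letter s k).1 -> stack s k != [::].
Hypothesis final_ok : stack s n = [::].
Implicit Types i j : 'I_n.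

(** The parent function of the word: elements without predecessor are its fixed points, as
    [parent_partition] expects. Under [pop_ok] the default of [head] is never reached. *)
Definition match_nat k := if (letter s k).1 then head 0 (stack s k) else k.

Definition match_ord i : 'I_n := insubd i (match_nat i).

Let match_lt k : k < n -> (letter s k).1 -> match_nat k < k.
Proof.
move=> ltkn pk; rewrite /match_nat pk; apply: (@stack_lt s).
by have := pop_ok ltkn pk; case: (stack s k) => // b r _; rewrite mem_head.
Qed.

Let match_le k : k < n -> match_nat k <= k.
Proof.
move=> ltkn; case: (boolP (letter s k).1) => [/(match_lt ltkn)/ltnW //|].
by rewrite /match_nat => /negbTE->.
Qed.

Let val_match i : match_ord i = match_nat i :> nat.
Proof. by rewrite val_insubd (leq_ltn_trans (match_le _)). Qed.

Let match_ltE i : (match_ord i < i) = (letter s i).1.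
Proof.
rewrite val_match; case: (boolP (letter s i).1) => [/match_lt->//|].
by rewrite /match_nat => /negbTE->; rewrite ltnn.
Qed.

Let match_ord_le i : match_ord i <= i.
Proof. by rewrite val_match match_le. Qed.

Let mem_match k : k < n -> (letter s k).1 -> match_nat k \in stack s k.
Proof.
move=> ltkn pk; rewrite /match_nat pk.
by have := pop_ok ltkn pk; case: (stack s k) => // b r _; rewrite mem_head.
Qed.

(** A common parent would be popped at [k] and yet, being on the stack at the later time [l], still
    be there at [k.+1]. *)
Let match_inj_lt k l : k < n -> l < n -> (letter s k).1 -> (letter s l).1 ->
  match_nat k = match_nat l -> k < l -> False.
Proof.
move=> kn ln pk pl E ltkl; have := mem_match ln pl; rewrite -E => mem.
have := stack_antimono (leqW (match_lt kn pk)) ltkl mem.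
by apply/negP; rewrite {1}/match_nat pk; apply: pop_notin => //; apply: pop_ok.
Qed.

Let match_inj i j :
  match_ord i < i -> match_ord j < j -> match_ord i = match_ord j -> i = j.
Proof.
rewrite !match_ltE => pi pj /(congr1 (@nat_of_ord n)); rewrite !val_match => E.
apply: ord_inj; apply/eqP; rewrite eqn_leq; apply/andP; split; rewrite leqNgt; apply/negP.
  by apply: match_inj_lt.
by apply: match_inj_lt.
Qed.

Definition word_partition := parent_partition match_ord.

Lemma word_partitionP : partition word_partition [set: 'I_n].
Proof. exact: parent_partitionP. Qed.

Lemma precedes_word i j : precedes word_partition i j =
  (letter s j).1 && (i == head 0 (stack s j) :> nat).
Proof.
rewrite /word_partition precedes_parent //.
apply/andP/andP => [[/eqP <-]|[pj /eqP Ei]].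
  by rewrite match_ltE val_match /match_nat => ->.
have Ej : match_ord j = i by apply: val_inj; rewrite /= val_match /match_nat pj.
by rewrite Ej eqxx; split=> //; rewrite -{1}Ej match_ltE.
Qed.

(** In a crossing [a < k < b < l], the start [k] is still open at [l], hence on the stack at [b];
    but the top of that stack is [a], its maximum. *)
Lemma word_partition_NC : word_partition \in NC n.
Proof.
rewrite inE word_partitionP; apply/forallP => a; apply/forallP => b.
apply/forallP => k; apply/forallP => l; apply/negP => /and5P[ak kb bl].
rewrite !precedes_word => /andP[pb /eqP Ea] /andP[pl /eqP Ek].
have kl : (k : nat) \in stack s l.
  by have := mem_match (ltn_ord l) pl; rewrite /match_nat pl Ek.
have := stack_head_max (stack_antimono kb (ltnW bl) kl).
by rewrite -Ea leqNgt ak.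
Qed.

Lemma has_pred_word i : has_pred word_partition i = (letter s i).1.
Proof.
apply/existsP/idP => [[a]|pi]; first by rewrite precedes_word => /andP[].
exists (match_ord i); rewrite precedes_word pi val_match /match_nat pi /=.
by rewrite eqxx.
Qed.

Lemma has_succ_word i : has_succ word_partition i = (letter s i).2.
Proof.
apply/existsP/idP => [[b]|qi].
  rewrite precedes_word => /andP[pb /eqP Ei].
  apply: (@stack_letter s b); have := mem_match (ltn_ord b) pb.
  by rewrite /match_nat pb Ei.
have mem0 : (i : nat) \in stack s i.+1 by rewrite /= qi mem_head.
(* Pushed at time [i], the position has left by time [n] as the final stack is empty; the element
   that pops it is its successor. *)
have popped k : k <= n -> i < k -> (i : nat) \notin stack s k ->
    exists b, precedes word_partition i b.
  elim: k => // k IHk ltkn; rewrite ltnS leq_eqVlt => /predU1P[<-|ltik] iN.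
    by case/negP: iN.
  case: (boolP ((i : nat) \in stack s k)) => [ik|]; last first.
    exact: IHk (ltnW ltkn) ltik.
  have [pk Ei] := notin_pop ik iN.
  by exists (Ordinal ltkn); rewrite precedes_word pk; apply/eqP.
by apply: (popped n); rewrite // final_ok.
Qed.

End WordPartition.

(** * From non-crossing partitions to words *)

Section WordOf.
Variable n : nat.
Implicit Types (P : {set {set 'I_n}}) (i a b : 'I_n).

Definition word P : n.-tuple (bool * bool) :=
  [tuple (has_pred P i, has_succ P i) | i < n].

Lemma letter_word P i : letter (word P) i = (has_pred P i, has_succ P i).
Proof. by rewrite /letter -tnth_nth tnth_mktuple. Qed.

Section NonCrossing.
Variable P : {set {set 'I_n}}.
Hypothesis NCP : P \in NC n.

Let partP : partition P [set: 'I_n].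
Proof. by move: NCP; rewrite inE => /andP[]. Qed.

Lemma NC_nested a b i j : precedes P a b -> precedes P i j ->
  i < b -> b < j -> i <= a.
Proof.
move=> ab ij ib bj; rewrite leqNgt; apply/negP => ai.
move: NCP; rewrite inE => /andP[_ /forallP/(_ a)/forallP/(_ b)].
by move=> /forallP/(_ i)/forallP/(_ j); rewrite ai ib bj ab ij.
Qed.

(** The invariant of the stack, by induction on [k]: a pop must remove exactly the arc that ends at
    [k], and this is where non-crossing enters. *)
Lemma mem_stack_word k a : k <= n ->
  (val a \in stack (word P) k) = (a < k) && [exists b, precedes P a b && (k <= b)].
Proof.
elim: k a => // k IHk a ltkn.
pose i := Ordinal ltkn.
have Ek : letter (word P) k = (has_pred P i, has_succ P i) by rewrite -letter_word.
rewrite /= Ek /=.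
have Epop : (val a \in (if has_pred P i then behead (stack (word P) k)
    else stack (word P) k)) =
    (a < k) && [exists b, precedes P a b && (k < b)].
  case: (boolP (has_pred P i)) => [/existsP[a0 a0i]|Npi]; last first.
    rewrite (IHk _ (ltnW ltkn)); congr (_ && _).
    apply: eq_existsb => b; case: (boolP (precedes P a b)) => //= ab.
    rewrite leq_eqVlt; case: eqP => //= Ekb; case/negP: Npi.
    by apply/existsP; exists a; rewrite (_ : i = b) //; apply: val_inj.
  have a0k : val a0 \in stack (word P) k.
    rewrite (IHk _ (ltnW ltkn)) (precedes_lt partP a0i : a0 < k) /=.
    by apply/existsP; exists i; rewrite a0i /=.
  (* The top is at least [a0] since the stack decreases. It starts an arc ending at [k], which is
     then the arc of [a0], or one ending later, which by [NC_nested] starts no later than [a0]. *)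
  have Ehead : head 0 (stack (word P) k) = a0.
    apply/eqP; rewrite eqn_leq (stack_head_max a0k) andbT.
    have : head 0 (stack (word P) k) \in stack (word P) k.
      by case: (stack _ k) a0k => // u r _; rewrite mem_head.
    move=> hk; have hn : head 0 (stack (word P) k) < n.
      exact: ltn_trans (stack_lt hk) ltkn.
    move: hk; rewrite -[head _ _]/(val (Ordinal hn)) (IHk _ (ltnW ltkn)).
    move=> /andP[hk /existsP[b /andP[hb]]]; rewrite leq_eqVlt.
    case/predU1P=> [Ekb|kb]; last exact: (NC_nested a0i hb).
    have Eb : b = i by apply: val_inj.
    by move: hb; rewrite Eb => /(precedes_injl partP a0i) ->.
  have := IHk a (ltnW ltkn); have := stack_uniq (word P) k.
  case: (stack (word P) k) Ehead a0k => //= u r -> _ /andP[Nr _] IH.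
  have Er : (val a \in r) = (val a != val a0) && (val a \in val a0 :: r).
    by rewrite inE; case: eqP => [->|] //=; apply/negbTE.
  rewrite Er IH; apply/andP/andP => [[Naa0 /andP[ak /existsP[b /andP[ab]]]]|].
    rewrite leq_eqVlt => /predU1P[Ekb|kb].
      have Eb : b = i by apply: val_inj.
      by move: ab Naa0; rewrite Eb => /(precedes_injl partP a0i) ->; rewrite eqxx.
    by split=> //; apply/existsP; exists b; rewrite ab.
  case=> ak /existsP[b /andP[ab kb]]; split.
    apply/eqP => /val_inj Ea; move: ab; rewrite Ea.
    by move=> /(precedes_injr partP a0i) Eb; move: kb; rewrite -Eb ltnn.
  by rewrite ak; apply/existsP; exists b; rewrite ab ltnW.
have [Eak|Nak] := eqVneq (val a) k.
  have Eai : a = i by apply: val_inj.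
  have Esucc : [exists b, precedes P a b && (k < b)] = has_succ P i.
    rewrite -Eai; apply: eq_existsb => b; case: (boolP (precedes P a b)) => //= ab.
    by have := precedes_lt partP ab; rewrite -Eak.
  have -> : (a < k.+1) by rewrite -Eak ltnSn.
  rewrite Esucc /=; case: ifP => _; first by rewrite -Eak mem_head.
  by rewrite Epop -{1}Eak ltnn.
rewrite ltnS leq_eqVlt (negbTE Nak : (nat_of_ord a == k) = false) /= -Epop.
by case: (has_succ P i) => //; rewrite inE (negbTE Nak).
Qed.

(** Two strictly decreasing lists with the same elements; the reversal reflects that the stack lists
    the latest start first. *)
Lemma stack_word_Gamma i : stack (word P) i = rev (map val (enum (Gamma P i))).
Proof.
apply: (irr_sorted_eq (leT := gtn)) => [a b k /= ? ?|k /=|||k].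
- lia.
- exact: ltnn.
- exact: stack_sorted.
- rewrite rev_sorted /enum_mem.
  apply: (subseq_sorted ltn_trans (map_subseq _ (filter_subseq _ _))).
  by rewrite -enumT val_enum_ord iota_ltn_sorted.
rewrite mem_rev; apply/idP/mapP => [ki|[a]].
  have kn : k < n := ltn_trans (stack_lt ki) (ltn_ord i).
  exists (Ordinal kn) => //; move: ki; rewrite mem_enum.
  rewrite -[k]/(val (Ordinal kn)) (mem_stack_word _ (ltnW (ltn_ord i))).
  move=> /andP[ki /existsP[b /andP[kb ib]]].
  by apply/(in_GammaP partP); exists b => //; apply/andP.
rewrite mem_enum => /(in_GammaP partP)[b ab /andP[ai ib]] ->.
by rewrite (mem_stack_word _ (ltnW (ltn_ord i))) ai; apply/existsP; exists b; rewrite ab.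
Qed.

Lemma size_stack_word i : size (stack (word P) i) = #|Gamma P i|.
Proof. by rewrite stack_word_Gamma size_rev size_map cardE. Qed.

Lemma stack_word_final : stack (word P) n = [::].
Proof.
case E: (stack (word P) n) => [//|k r].
have kn : k \in stack (word P) n by rewrite E mem_head.
have := kn; rewrite -[k]/(val (Ordinal (stack_lt kn))) mem_stack_word //.
by case/andP=> _ /existsP[b /andP[_]]; rewrite leqNgt ltn_ord.
Qed.

Lemma precedes_NC a i : precedes P a i =
  (letter (word P) i).1 && (val a == head 0 (stack (word P) i)).
Proof.
rewrite letter_word /=.
have headE b : precedes P b i -> head 0 (stack (word P) i) = val b.
  move=> bi; have bst : val b \in stack (word P) i.
    rewrite (mem_stack_word _ (ltnW (ltn_ord i))) (precedes_lt partP bi).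
    by apply/existsP; exists i; rewrite bi /=.
  apply/eqP; rewrite eqn_leq (stack_head_max bst) andbT.
  have hk : head 0 (stack (word P) i) \in stack (word P) i.
    by case: (stack _ i) bst => // u r _; rewrite mem_head.
  have hn : head 0 (stack (word P) i) < n := ltn_trans (stack_lt hk) (ltn_ord i).
  move: hk; rewrite -[head _ _]/(val (Ordinal hn)) (mem_stack_word _ (ltnW (ltn_ord i))).
  move=> /andP[hk /existsP[j /andP[hj]]]; rewrite leq_eqVlt.
  case/predU1P=> [/val_inj Eij|ij]; last exact: (NC_nested bi hj).
  by move: hj; rewrite -Eij => /(precedes_injl partP bi) ->.
apply/idP/andP => [ai|[/existsP[b bi]]].
  by split; [apply/existsP; exists a | rewrite (headE _ ai)].
by rewrite (headE _ bi) => /eqP/val_inj->.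
Qed.

(** The predecessor is the top of the stack, thus the last entry of the increasing list of
    [Gamma P i]. *)
Lemma gamma_NC i : has_pred P i -> gamma P i = #|Gamma P i|.
Proof.
move=> pi; rewrite /gamma; case: pickP => [a ai|]; last first.
  by case/existsP: pi => a ai /(_ a); rewrite ai.
have := ai; rewrite precedes_NC => /andP[_ /eqP Ea].
have : val a \in stack (word P) i.
  rewrite (mem_stack_word _ (ltnW (ltn_ord i))) (precedes_lt partP ai).
  by apply/existsP; exists i; rewrite ai /=.
move: Ea; rewrite cardE stack_word_Gamma.
have := enum_uniq (Gamma P i); case/lastP: (enum _) => // r b.
rewrite map_rcons rev_rcons /= rcons_uniq => /andP[Nr _] /val_inj-> _.
by rewrite -cats1 index_cat (negbTE Nr) /= eqxx addn0 size_cat addn1.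
Qed.

Lemma gamma_eq0 i : ~~ has_pred P i -> gamma P i = 0.
Proof.
move=> /existsPn Npi; rewrite /gamma; case: pickP => // a ai.
by case/negP: (Npi a).
Qed.

End NonCrossing.

Lemma word_inj : {in NC n &, injective word}.
Proof.
move=> P Q NCP NCQ E.
have [partP partQ] : partition P [set: 'I_n] /\ partition Q [set: 'I_n].
  by move: NCP NCQ; rewrite !inE => /andP[? _] /andP[? _].
by apply: precedes_inj => // a b; rewrite !precedes_NC // E.
Qed.

Lemma word_surj (s : n.-tuple (bool * bool)) :
    (forall k, k < n -> (letter s k).1 -> stack s k != [::]) ->
    stack s n = [::] ->
  exists2 P, P \in NC n & word P = s.
Proof.
move=> pop_ok final_ok; exists (word_partition n s); first exact: word_partition_NC.
apply: eq_from_tnth => i; rewrite tnth_mktuple has_pred_word // has_succ_word //.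
by rewrite (tnth_nth (false, false)) -/(letter s i) -surjective_pairing.
Qed.

End WordOf.

(** * Weights of words *)

Section PathWeight.
Variables (R : realType) (c t : nat -> R).
Local Open Scope ring_scope.
Implicit Types s : seq (bool * bool).

Definition step_weight (h : nat) (u : bool * bool) : R :=
  c h.+1 * (if u.1 then t h else 1).

(** Steps below the axis are not excluded here: they carry the factor [t 0], which is later assumed
    to vanish. *)
Fixpoint path_weight (h : nat) s : R :=
  if s is u :: r then step_weight h u * path_weight (next_height h u) r
  else (h == 0%N)%:R.

Lemma path_weightE h s : path_weight h s =
  (\prod_(i < size s) step_weight (foldl next_height h (take i s)) (letter s i))
  * (foldl next_height h s == 0%N)%:R.
Proof.
elim: s h => [|u s IHs] h /=; first by rewrite big_ord0 mul1r.
by rewrite IHs big_ord_recl /= mulrA.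
Qed.

Lemma path_weight_stack n (s : n.-tuple (bool * bool)) : path_weight 0 s =
  (\prod_(i < n) step_weight (size (stack s i)) (letter s i))
  * (size (stack s n) == 0%N)%:R.
Proof.
rewrite path_weightE size_stack ?size_tuple // take_oversize ?size_tuple //.
congr (_ * _); apply: eq_bigr => i _; rewrite size_stack // size_tuple.
exact/ltnW/ltn_ord.
Qed.

Lemma NC_weight n (P : {set {set 'I_n}}) : P \in NC n ->
  \prod_(1 <= k < n.+1) (c k ^+ ell_stat P k.-1 * t k ^+ g_stat P k) =
  path_weight 0 (word P).
Proof.
move=> NCP; have partP : partition P [set: 'I_n].
  by move: NCP; rewrite inE => /andP[].
rewrite path_weight_stack stack_word_final //= mulr1.
rewrite [RHS]big_split big_split; congr (_ * _).
  rewrite big_add1 /= big_mkord.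
  have rank_lt (i : 'I_n) : (#|Gamma P i| < n)%N.
    exact: leq_ltn_trans (card_Gamma_le P i) (ltn_ord i).
  (* Elements are grouped by the size of [Gamma]; the class of size [k] contributes [c k.+1], once
     per element. *)
  rewrite [RHS](partition_big (fun i => Ordinal (rank_lt i)) xpredT) //=.
  apply: eq_bigr => k _; rewrite -prodr_const; apply: esym.
  apply: eq_big => [i|i /eqP <-]; first by rewrite inE.
  by rewrite size_stack_word.
rewrite big_add1 /= big_mkord.
under [RHS]eq_bigr do rewrite letter_word /= size_stack_word //.
rewrite -[RHS]big_mkcond /=.
have gamma_range (i : 'I_n) : has_pred P i -> (0 < gamma P i <= n)%N.
  move=> pi; rewrite {1}/gamma; case: pickP => [a ai|]; last first.
    by case/existsP: pi => a ai /(_ a); rewrite ai.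
  rewrite gamma_NC //=; apply: leq_trans (card_Gamma_le P i) _.
  exact/ltnW/ltn_ord.
(* Elements with a predecessor are grouped by [gamma], shifted down to start at 0. The others, with
   [gamma] equal to 0, are filtered out of the product but still need an index below [n]. *)
have rank_lt (i : 'I_n) : ((gamma P i).-1 < n)%N.
  case: (boolP (has_pred P i)) => [/gamma_range/andP[]|/gamma_eq0->].
    by case: gamma.
  exact: leq_ltn_trans (ltn_ord i).
rewrite [RHS](partition_big (fun i => Ordinal (rank_lt i)) xpredT) //=.
apply: eq_bigr => k _; rewrite -prodr_const; apply: esym.
apply: eq_big => [i|i /andP[pi /eqP <-]] /=.
  rewrite inE in_setU in_closers // in_transients // -andb_orr orNb andbT.
  case: (boolP (has_pred P i)) => //= /gamma_range /andP[gi _].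
  by rewrite -val_eqE /= -(prednK gi).
by rewrite prednK ?gamma_NC //; have := gamma_range i pi; rewrite gamma_NC // => /andP[].
Qed.

Lemma sum_NC_words n : t 0 = 0 ->
  \sum_(P in NC n)
     \prod_(1 <= k < n.+1) (c k ^+ ell_stat P k.-1 * t k ^+ g_stat P k) =
  \sum_(s : n.-tuple (bool * bool)) path_weight 0 s.
Proof.
move=> t0; rewrite (eq_bigr _ (@NC_weight n)).
rewrite -(big_imset (fun s : n.-tuple _ => path_weight 0 s) (@word_inj n)) /=.
rewrite [RHS](bigID [in @word n @: NC n]) /=.
rewrite [X in _ = _ + X]big1 ?addr0 // => s Ns; apply/eqP.
(* A nonzero weight forces an empty final stack and no factor [t 0], hence no pop of an empty stack;
   [word_surj] then puts the word in the image. *)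
apply: contraR Ns; rewrite path_weight_stack mulf_eq0 negb_or.
case/andP=> /prodf_neq0 nz; rewrite pnatr_eq0 eqb0 negbK size_eq0 => /eqP fin.
have [k ltkn pk||P NCP <-] := @word_surj _ s; last by rewrite imset_f.
  have := nz (Ordinal ltkn) isT; rewrite /step_weight pk mulf_eq0 negb_or /=.
  by case/andP=> _; apply: contraNneq => ->; rewrite t0.
by [].
Qed.

Lemma sum_tuple_cons (n : nat) (T : finType) (F : seq T -> R) :
  \sum_(s : n.+1.-tuple T) F s = \sum_(u : T) \sum_(s : n.-tuple T) F (u :: s).
Proof.
rewrite pair_big /=.
rewrite (reindex (fun p : T * n.-tuple T => [tuple of p.1 :: p.2])) //=.
exists (fun s : n.+1.-tuple T => (thead s, [tuple of behead s])) => [[u s] _|s _].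
  by congr pair; apply: val_inj.
by rewrite -tuple_eta.
Qed.

Definition path_sum (h n : nat) : R :=
  \sum_(s : n.-tuple (bool * bool)) path_weight h s.

Lemma path_sum0 h : path_sum h 0 = (h == 0%N)%:R.
Proof.
rewrite /path_sum (big_pred1 [tuple]) // => s.
by apply/esym/eqP/val_inj; case: s => -[].
Qed.

Lemma path_sumS h n : t 0 = 0 -> path_sum h n.+1 =
  c h.+1 * t h * path_sum h.-1 n + c h.+1 * (1 + t h) * path_sum h n
  + c h.+1 * path_sum h.+1 n.
Proof.
move=> t0; rewrite /path_sum sum_tuple_cons.
under eq_bigr => u _ do rewrite /= -mulr_sumr.
rewrite -(pair_big xpredT xpredT (fun p q => step_weight h (p, q) *
  \sum_(s : n.-tuple (bool * bool)) path_weight (next_height h (p, q)) s)) /=.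
rewrite !big_bool /next_height /step_weight /=.
(* At height 0, where truncation gives wrong target heights, both letters with a predecessor are
   killed by [t 0 = 0]. *)
case: h => [|h] /=; last by rewrite !subn0 !addn0 !addn1 subn1 /=; ring.
by rewrite t0 ?subn0 ?addn0 ?addn1 ?sub0n ?add0n; ring.
Qed.

End PathWeight.

(** * The continued fraction *)

Section PowerSeries.
Variable R : realType.
Local Open Scope ring_scope.
Implicit Types (f g u : nat -> R) (a b d : R).

Lemma eq_fps_mul f f' g g' : f =1 f' -> g =1 g' -> fps_mul f g =1 fps_mul f' g'.
Proof. by move=> Ef Eg n; apply: eq_bigr => i _; rewrite Ef Eg. Qed.

Lemma fps_mul1l f : fps_mul (@fps_one R) f =1 f.
Proof.
move=> n; rewrite /fps_mul big_ord_recl /= subn0 mul1r big1 ?addr0 //.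
by move=> i _; rewrite /= mul0r.
Qed.

Lemma fps_mulDl f g u n :
  fps_mul (fun k => f k + g k) u n = fps_mul f u n + fps_mul g u n.
Proof. by rewrite -big_split; apply: eq_bigr => i _; rewrite mulrDl. Qed.

Lemma fps_mul_poly N f g n : (n < N)%N ->
  fps_mul f g n = ((\poly_(i < N) f i) * (\poly_(i < N) g i))`_n.
Proof.
move=> ltnN; rewrite coefM; apply: eq_bigr => i _.
rewrite !coef_poly (leq_ltn_trans (leq_subr _ _) ltnN).
by rewrite (leq_trans (ltn_ord i) ltnN).
Qed.

(** The coefficient of index [n] depends only on the truncations to degree at most [n], so
    associativity comes from polynomials. *)
Lemma fps_mulA f g u : fps_mul f (fps_mul g u) =1 fps_mul (fps_mul f g) u.
Proof.
move=> n; pose p f := \poly_(i < n.+1) f i : {poly R}.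
transitivity ((p f * (p g * p u))`_n).
  rewrite coefM; apply: eq_bigr => i _.
  by rewrite coef_poly ltn_ord (@fps_mul_poly n.+1) // ltnS leq_subr.
rewrite mulrA coefM; apply: eq_bigr => i _.
by rewrite coef_poly ltnS leq_subr (@fps_mul_poly n.+1).
Qed.

Definition fps_shift d f (n : nat) : R := if n is m.+1 then d * f m else 0.

(** Rewrites b d z^2 f g as (b z) f (d z g): one factor z stays with the up step of weight [b], the
    other moves to the down step of weight [d]. *)
Lemma fps_mul_step a b d f g n : fps_mul (fps_step a (b * d) f) g n.+1 =
  a * g n + b * fps_mul f (fps_shift d g) n.
Proof.
rewrite {1}/fps_mul !big_ord_recl /= mul0r add0r subSS subn0; congr (_ + _).
rewrite /fps_mul big_ord_recr /= subnn mulr0 addr0 mulr_sumr.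
apply: eq_bigr => i _; rewrite /bump /= !add1n !subSS.
by rewrite -(subnSK (ltn_ord i)) /=; ring.
Qed.

End PowerSeries.

(** * Tails of the continued fraction as path series *)

Section MomentPaths.
Variables (R : realType) (x y c t : nat -> R).
Local Open Scope ring_scope.
Hypothesis t0 : t 0%N = 0.
Hypothesis x_def : forall k, (1 <= k)%N -> x k = c k * (1 + t k.-1).
Hypothesis y_def : forall k, (1 <= k)%N -> y k = c k * c k.+1 * t k.

(** The infinite fraction starting at level [k]; by [jfrac_stable], [n.+1] levels already determine
    the coefficient of z^n. *)
Definition jtail k n : R := jfrac x y n.+1 k n.

Lemma jtailE k n : jtail k n =
  fps_one R n + fps_mul (fps_step (x k.+1) (y k.+1) (jtail k.+1)) (jtail k) n.
Proof.
have jtail_geom m : jtail k m = fps_geom (fps_step (x k.+1) (y k.+1) (jtail k.+1)) m.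
  rewrite /jtail /=; apply: eq_bigr => j _; apply: eq_fps_pow.
  by case=> [|[|i]] //= ltim; rewrite (@jfrac_stable _ _ _ m i.+1) // ltnW.
rewrite jtail_geom fps_geomE //; congr (_ + _).
by apply: eq_fps_mul => // m; rewrite jtail_geom.
Qed.

(* The series of the weighted paths from height h to 0, decomposed at the      *)
(* first visits to h - 1, ..., 0; the weight of the down step from h is        *)
(* c h.+1 * t h.                                                               *)
Fixpoint descent h : nat -> R :=
  fps_mul (jtail h)
    (if h is k.+1 then fps_shift (c h.+1 * t h) (descent k) else fps_one R).

Let tail_part h :=
  if h is k.+1 then fps_shift (c h.+1 * t h) (descent k) else fps_one R.

Let descent_tail h : descent h = fps_mul (jtail h) (tail_part h).
Proof. by case: h. Qed.

(** This is the fixed-point equation [jtailE] multiplied by [tail_part h]. *)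
Lemma descentE h n : descent h n = tail_part h n +
  fps_mul (fps_step (x h.+1) (y h.+1) (jtail h.+1)) (descent h) n.
Proof.
rewrite descent_tail (eq_fps_mul (jtailE h) (frefl _)) fps_mulDl fps_mul1l.
by rewrite -fps_mulA.
Qed.

Lemma descentS h n : descent h n.+1 =
  c h.+1 * t h * descent h.-1 n + c h.+1 * (1 + t h) * descent h n
  + c h.+1 * descent h.+1 n.
Proof.
(* With [y h.+1] grouped as [c h.+1 * (c h.+2 * t h.+1)], the product of [jtail h.+1] and the
   shifted [descent h] is [descent h.+1] by definition. *)
rewrite descentE y_def // -mulrA fps_mul_step x_def // addrA; congr (_ + _ + _).
by case: h => //=; rewrite t0 mulr0 mul0r.
Qed.

Lemma descent0 h : descent h 0 = (h == 0%N)%:R.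
Proof.
rewrite descentE /fps_mul big_ord1 /= mul0r addr0.
by case: h.
Qed.

Lemma path_sum_descent h n : path_sum c t h n = descent h n.
Proof.
elim: n h => [|n IHn] h; first by rewrite path_sum0 descent0.
by rewrite path_sumS // descentS !IHn.
Qed.

Lemma moment_path_sum n : moment x y n = path_sum c t 0 n.
Proof.
rewrite path_sum_descent /= /fps_mul big_ord_recr /= subnn mulr1 big1 ?add0r //.
by move=> i _; rewrite /fps_one subn_eq0 leqNgt ltn_ord mulr0.
Qed.

End MomentPaths.

Local Open Scope ring_scope.

Theorem proposition8p8 (R : realType) (x y c t : nat -> R)
    (xy_tp : totally_positive x y)
    (c_gt0 : forall k : nat, (1 <= k)%N -> 0 < c k)
    (t_gt0 : forall k : nat, (1 <= k)%N -> 0 < t k)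
    (t0 : t 0%N = 0)
    (x_def : forall k : nat, (1 <= k)%N -> x k = c k * (1 + t k.-1))
    (y_def : forall k : nat, (1 <= k)%N -> y k = c k * c k.+1 * t k)
    (n : nat) :
  moment x y n =
    \sum_(P in NC n)
      \prod_(1 <= k < n.+1) (c k ^+ ell_stat P k.-1 * t k ^+ g_stat P k).
Proof. by rewrite (moment_path_sum t0 x_def y_def) sum_NC_words. Qed.
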